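(* Let $\Phi:X\to Y$ be a complete simulation by a discrete dynamical system $(X,F)$ of another discrete dynamical system $(Y,G)$. Then $\Phi(\omega_F)=\omega_G$.
   Context: A discrete dynamical system (DDS) is a pair $(X,F)$ with $X$ a nonempty compact metric space and $F:X\to X$ continuous. A factor map of $(X,F)$ onto $(Y,G)$ is a continuous surjective map $\Phi:X\to Y$ with $\Phi F=G\Phi$. A complete simulation by $(X,F)$ of $(Y,G)$ is a map $\Phi:X\to Y$ which, for some integers $n,n'\ge1$, is a factor map of $(X,F^n)$ onto $(Y,G^{n'})$. The asymptotic set $\omega_F$ of a DDS $(X,F)$ is the set of all $y\in X$ such that for some $x\in X$, $y$ is an adhering value (the limit of a subsequence) of the sequence $(F^t(x))_{t\in\mathbb N}$. *)

(* Defs.v *)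
From mathcomp Require Import all_boot all_order all_algebra.
From mathcomp Require Import all_classical all_reals all_analysis.

Set Implicit Arguments.
Unset Strict Implicit.
Unset Printing Implicit Defensive.

Local Open Scope classical_set_scope.

Definition is_dds (R : realType) (X : metricType R) (F : X -> X) : Prop :=
  [/\ [set: X] !=set0, compact [set: X] & continuous F].

Definition factor_map (R : realType) (X Y : metricType R)
    (F : X -> X) (G : Y -> Y) (Phi : X -> Y) : Prop :=
  [/\ continuous Phi, set_surj [set: X] [set: Y] Phi & Phi \o F =1 G \o Phi].

Definition complete_simulation (R : realType) (X Y : metricType R)
    (F : X -> X) (G : Y -> Y) (Phi : X -> Y) : Prop :=
  exists n n' : nat,
    [/\ (1 <= n)%N, (1 <= n')%N & factor_map (iter n F) (iter n' G) Phi].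

(* Subsequences are given by strictly increasing reindexings: for functions
   from nat to nat, increasing_seq means strictly increasing. *)
Definition adhering_value (R : realType) (X : metricType R)
    (u : nat -> X) (y : X) : Prop :=
  exists2 s : nat -> nat, increasing_seq s & u \o s @ \oo --> y.

Definition asymptotic_set (R : realType) (X : metricType R) (F : X -> X)
    : set X :=
  [set y | exists x : X, adhering_value (fun t => iter t F x) y].

(* Main.v *)
Require Import Defs.
From mathcomp Require Import all_boot all_order all_algebra.
From mathcomp Require Import all_classical all_reals all_analysis.

Import Order.TTheory Num.Theory.

Local Open Scope classical_set_scope.

(** The asymptotic set does not see the difference between a system and its
    positive iterates ([asymptotic_set_iter]), so a complete simulation may be
    replaced by the factor map that it is between [F^n] and [G^n'], and it
    suffices to treat factor maps ([factor_map_asymptotic_set]).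

    For the iterates: a limit along times [s k] of an [F^n]-orbit is the limit
    along times [n * s k] of the same [F]-orbit.  Conversely, given times [s k]
    of the [F]-orbit of [x], some residue [r] modulo [n] is taken infinitely
    often; along those times, [F^(s k) x] is [(F^n)^(s k %/ n)] applied to the
    single point [F^r x].

    For a factor map [Phi]: continuity sends limits along an orbit of [x] to
    limits along the orbit of [Phi x].  Conversely, if [y] is the limit of
    [G^(s k) (Phi x)], compactness of [X] gives a further subsequence along
    which [F^(s k) x] converges to some [z], and [Phi z = y] because limits are
    unique in [Y]. *)

Lemma increasing_seq_cvg_infty {s : nat -> nat} :
  increasing_seq s -> s @ \oo --> \oo.
Proof.
move=> s_incr.
have le_s k : (k <= s k)%N.
  elim: k => // k /leq_ltn_trans; apply.
  by move/increasing_seqP : s_incr; exact.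
apply/cvgnyPge => N; exists N => // k /= Nk.
exact: leq_trans Nk (le_s k).
Qed.

(** Since the balls of radius [1 / k.+1] form a countable basis at [y], terms
    [u j] with [j] arbitrarily large can be picked inductively in smaller and
    smaller balls. *)
Lemma cluster_adhering_value {R : realType} {X : metricType R}
    (u : nat -> X) (y : X) :
  cluster (u @ \oo) y -> adhering_value u y.
Proof.
move=> uy.
have near_y (p : nat * nat) :
    exists j, (p.2 < j)%N /\ ball y (p.1.+1%:R^-1 : R)%R (u j).
  have [] := uy [set u j | j in [set j | (p.2 < j)%N]]
                (ball y (p.1.+1%:R^-1 : R)%R).
  - by exists p.2.+1 => // j /= pj; exists j.
  - by apply: nbhsx_ballx; rewrite invr_gt0 ltr0n.
  - by move=> _ [[j /= pj <-] yj]; exists j.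
have [g g_near] := choice near_y.
pose s := nat_rect (fun=> nat) (g (0, 0)%N) (fun k N => g (k.+1, N)).
have s_ball k : ball y (k.+1%:R^-1 : R)%R (u (s k)).
  by case: k => [|k]; apply: (g_near (_, _)).2.
exists s.
  by apply/increasing_seqP => k; exact: (g_near (k.+1, s k)).1.
apply/cvg_ballP => e e0; near=> k.
apply: le_ball (s_ball k).
rewrite invf_ple ?posrE// ?ltr0n//.
rewrite (@le_trans _ _ k%:R%R)//.
  by near: k; exact: nbhs_infty_ger.
by rewrite ler_nat.
Unshelve. all: end_near. Qed.

Lemma compact_adhering_value {R : realType} {X : metricType R} (u : nat -> X) :
  compact [set: X] -> exists y, adhering_value u y.
Proof.
move=> cX; have [y [_ uy]] := cX (u @ \oo) _ filterT.
by exists y; exact: cluster_adhering_value.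
Qed.

(** The pigeonhole principle in the form that serves for the residues of the
    times of a subsequence. *)
Lemma bounded_cst_subsequence (v : nat -> nat) (n : nat) :
  (forall k, (v k < n)%N) ->
  exists r, exists2 f : nat -> nat, increasing_seq f & forall k, v (f k) = r.
Proof.
move=> vn.
have /finite_range_cst_subsequence [r [A Aoo Av]] : finite_set (range v).
  by apply: sub_finite_set (finite_II n) => _ [k _ <-]; exact: vn.
have [m|f [f_incr _ Af]] := infinite_increasing_seq_wf _ Aoo 0%N.
  by apply: sub_finite_set (finite_II m.+1) => j /=.
by exists r, f => // k; apply/Av.
Qed.

Lemma asymptotic_set_iter {R : realType} {X : metricType R}
    (F : X -> X) {n : nat} :
  (0 < n)%N -> asymptotic_set (iter n F) = asymptotic_set F.
Proof.
move=> n0; apply/seteqP; split=> y [x [s s_incr sy]].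
  exists x, (fun k => s k * n)%N.
    by move=> i j /=; rewrite leEnat leq_pmul2r// -leEnat s_incr.
  have -> // : (fun t => iter t F x) \o (fun k => s k * n)%N
      = (fun t => iter t (iter n F) x) \o s.
  by apply/funext => k /=; rewrite iterM.
have [k|r [f f_incr s_mod]] := @bounded_cst_subsequence (fun k => s k %% n) n.
  by rewrite ltn_mod.
have sfE k : s (f k) = (s (f k) %/ n * n + r)%N.
  by rewrite {1}(divn_eq (s (f k)) n) s_mod.
exists (iter r F x), (fun k => s (f k) %/ n).
  apply/increasing_seqP => k.
  have : (s (f k) < s (f k.+1))%O.
    by move/increasing_seqP : f_incr => /(_ k); rewrite (leW_mono s_incr).
  (* both times leave the remainder [r], so their quotients compare alike *)
  rewrite [X in (X < _)%O]sfE [X in (_ < X)%O]sfE.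
  by rewrite !ltEnat /= ltn_add2r ltn_pmul2r.
have -> : (fun t => iter t (iter n F) (iter r F x)) \o (fun k => s (f k) %/ n)
    = ((fun t => iter t F x) \o s) \o f.
  by apply/funext => k /=; rewrite [in RHS]sfE iterD iterM.
exact: (cvg_comp _ _ (increasing_seq_cvg_infty f_incr) sy).
Qed.

Lemma factor_map_asymptotic_set {R : realType} {X Y : metricType R}
    (F : X -> X) (G : Y -> Y) (Phi : X -> Y) :
  compact [set: X] -> factor_map F G Phi ->
  Phi @` asymptotic_set F = asymptotic_set G.
Proof.
move=> cX [Phi_cont Phi_surj PhiF].
have Phi_iter x : Phi \o (fun t => iter t F x) = fun t => iter t G (Phi x).
  by apply/funext; elim=> //= t <-; exact: PhiF.
have Phi_cvg (v : nat -> X) z : v @ \oo --> z -> Phi \o v @ \oo --> Phi z.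
  by move=> vz; exact: (cvg_comp _ _ vz (Phi_cont z)).
apply/seteqP; split=> [_ [z [x [s s_incr sz]] <-]|y [y0 [s s_incr sy]]].
  by exists (Phi x), s => //; rewrite -Phi_iter; exact: Phi_cvg sz.
have [x _ xy0] := Phi_surj y0 I; subst y0.
have [z [f f_incr fz]] := compact_adhering_value (fun k => iter (s k) F x) cX.
exists z.
  by exists x, (s \o f) => // i j; rewrite /= s_incr -leEnat f_incr.
apply: (cvg_unique (@metric_hausdorff _ Y) (Phi_cvg _ _ fz)).
move: sy; rewrite -Phi_iter => sy.
exact: (cvg_comp _ _ (increasing_seq_cvg_infty f_incr) sy).
Qed.

Theorem proposition22 (R : realType) (X Y : metricType R)
    (F : X -> X) (G : Y -> Y) (Phi : X -> Y)
    (ddsF : is_dds F) (ddsG : is_dds G)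
    (simPhi : complete_simulation F G Phi) :
  Phi @` asymptotic_set F = asymptotic_set G.
Proof.
have [_ cX _] := ddsF; have [n [n' [n0 n'0 Phi_factor]]] := simPhi.
rewrite -(asymptotic_set_iter F n0) -(asymptotic_set_iter G n'0).
exact: factor_map_asymptotic_set.
Qed.
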